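(* Let $p,q$ be positive integers, let $A\in\mathscr{K}^{p,q}$, and let $\mathbf{a}=(A_b)_{b\in\mathcal{E}}$ be the associated vector of entries of $A$ indexed by $\mathcal{E}$. Let $R\in\Sigma[x,y]_6$, let $h=(x^Tx-1,\ y^Ty-1)$ and $g=(\mathbf{1}_p^Tx,\ \mathbf{1}_q^Ty)$, and for integers $k\ge3$ consider the semidefinite relaxation $$\min\ \langle R,w\rangle\quad\text{s.t.}\quad w|_{\mathcal{E}}=\mathbf{a},\ L_h^{(k)}(w)=0,\ M_k(w)\succeq0,\ L_g^{(k)}(w)\succeq0,\ w\in\mathbb{R}^{\mathbb{M}[x,y]_{2k}}. \qquad(\ast)$$ Then: (i) If $(\ast)$ is infeasible for some $k$, then $A$ is not separable, i.e., $A\notin\mathscr{S}^{p,q}$. (ii) If $A\notin\mathscr{S}^{p,q}$, then $(\ast)$ is infeasible when $k$ is big enough.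
   Context: $\mathcal{S}^k$ is the space of real symmetric $k\times k$ matrices, $\mathcal{S}^k_+$ the cone of positive semidefinite ones; $X\succeq0$ means positive semidefinite. $\mathbf{1}_p$ is the all-ones vector in $\mathbb{R}^p$. For $B\in\mathcal{S}^p$, $C\in\mathcal{S}^q$, $B\otimes C=(B_{ik}C)_{1\le i,k\le p}$ is the Kronecker product. $\mathscr{K}^{p,q}=\operatorname{span}\{B\otimes C: B\in\mathcal{S}^p, C\in\mathcal{S}^q\}\subseteq\mathcal{S}^{pq}$. A matrix $A\in\mathscr{K}^{p,q}$ is separable if $A=\sum_{j=1}^LB_j\otimes C_j$ for some $L$ and some $B_j\in\mathcal{S}^p_+$, $C_j\in\mathcal{S}^q_+$; $\mathscr{S}^{p,q}$ is the cone of separable matrices. Variables are $x=(x_1,\dots,x_p)$, $y=(y_1,\dots,y_q)$. $\mathcal{E}=\{x_iy_jx_ky_l:1\le i\le k\le p,\ 1\le j\le l\le q\}$, and for $b=x_iy_jx_ky_l\in\mathcal{E}$ one sets $A_b:=A_{(i-1)q+j,\,(k-1)q+l}$; the vector $(A_b)_{b\in\mathcal{E}}$ determines $A\in\mathscr{K}^{p,q}$ uniquely. $\mathbb{M}[x,y]_d$ is the set of monomials in $(x,y)$ of degree at most $d$. $\Sigma[x,y]_6$ is the set of sums of squares of real polynomials in $(x,y)$ that have degree at most $6$. Elements $w\in\mathbb{R}^{\mathbb{M}[x,y]_{d}}$ are real vectors indexed by the monomials in $\mathbb{M}[x,y]_d$; for $f=\sum c_{\alpha,\beta}x^\alpha y^\beta$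 of degree at most $d$, $\langle f,w\rangle:=\sum c_{\alpha,\beta}w_{x^\alpha y^\beta}$; $w|_{\mathcal{E}}$ is the subvector of $w$ indexed by $\mathcal{E}$. For $w\in\mathbb{R}^{\mathbb{M}[x,y]_{2k}}$ and a polynomial $\theta$ with $\deg\theta\le2k$, the localizing matrix $L_\theta^{(k)}(w)$ is the symmetric matrix satisfying $\mathrm{vec}(f_1)^TL_\theta^{(k)}(w)\,\mathrm{vec}(f_2)=\langle\theta f_1f_2,w\rangle$ for all polynomials $f_1,f_2$ of degree at most $k-\lceil\deg(\theta)/2\rceil$, where $\mathrm{vec}(f)$ is the coefficient vector of $f$. $M_k(w):=L_1^{(k)}(w)$ is the moment matrix. $L_h^{(k)}(w)=0$ means $L_{h_i}^{(k)}(w)=0$ for every $i$, and $L_g^{(k)}(w)\succeq0$ means $L_{g_j}^{(k)}(w)\succeq0$ for every $j$. *)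

(* Defs.v *)
From mathcomp Require Import all_boot all_order all_algebra.
From mathcomp Require Import reals.
From mathcomp Require Import mpoly mxtens.
From mathcomp Require Import zify.

Set Implicit Arguments.
Unset Strict Implicit.
Unset Printing Implicit Defensive.

Import Order.TTheory GRing.Theory Num.Theory.
Local Open Scope ring_scope.

Definition psdmx (R : realType) n (A : 'M[R]_n) : Prop :=
  A^T = A /\ forall v : 'cV[R]_n, 0 <= (v^T *m A *m v) 0 0.

(* [tensmx B C] is the Kronecker product: its entry at row [mxtens_index (i, j)],
   which is [i * q + j] counting from 0, and column [mxtens_index (k, l)]
   is [B i k * C j l]. *)
Definition kron_space (R : realType) p q (A : 'M[R]_(p * q)) : Prop :=
  exists (L : nat) (c : 'I_L -> R) (B : 'I_L -> 'M[R]_p) (C : 'I_L -> 'M[R]_q),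
    (forall s, (B s)^T = B s /\ (C s)^T = C s) /\
    A = \sum_(s < L) c s *: tensmx (B s) (C s).

Definition separable_mx (R : realType) p q (A : 'M[R]_(p * q)) : Prop :=
  kron_space A /\
  exists (L : nat) (B : 'I_L -> 'M[R]_p) (C : 'I_L -> 'M[R]_q),
    (forall s, psdmx (B s) /\ psdmx (C s)) /\
    A = \sum_(s < L) tensmx (B s) (C s).

(* The polynomial ring R[x, y]: the first p of the p + q variables are the x_i,
   the other q are the y_j. *)
Definition polyxy (R : realType) p q := {mpoly R[p + q]}.

Definition xvar (R : realType) p q (i : 'I_p) : polyxy R p q := 'X_(lshift q i).
Definition yvar (R : realType) p q (j : 'I_q) : polyxy R p q := 'X_(rshift p j).

(* [msize f <= d.+1] says that f has degree at most d. *)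
Definition sos_le (R : realType) p q d (f : polyxy R p q) : Prop :=
  (msize f <= d.+1)%N /\
  exists s : seq (polyxy R p q), f = \sum_(u <- s) u ^+ 2.

(* Real vectors indexed by the monomials of degree at most d in n variables. *)
Definition momseq (R : realType) n d := {ffun 'X_{1..n < d.+1} -> R}.

(* The entry of w at the monomial m; the value 0 is only a placeholder for
   monomials of degree greater than d, at which w has no entry. *)
Definition mom_at (R : realType) n d (w : momseq R n d) (m : 'X_{1..n}) : R :=
  oapp w 0 (insub m).

(* <f, w>, for f of degree at most d. *)
Definition riesz (R : realType) n d (f : {mpoly R[n]}) (w : momseq R n d) : R :=
  \sum_(m : 'X_{1..n < d.+1}) f@_m * w m.

(* The monomials of degree at most d, numbered to index rows and columns. *)
Definition nmon n d : nat := #|{: 'X_{1..n < d.+1}}|.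
Definition mon n d (a : 'I_(nmon n d)) : 'X_{1..n} :=
  bmnm (enum_val a : 'X_{1..n < d.+1}).

Definition coefvec (R : realType) n d (f : {mpoly R[n]}) :
    'cV[R]_(nmon n d) :=
  \col_a f@_(mon a).

(* k - ceil(deg(theta) / 2); for theta != 0 the degree is (msize theta).-1. *)
Definition loc_deg (R : realType) n (k : nat) (theta : {mpoly R[n]}) : nat :=
  (k - uphalf (msize theta).-1)%N.

Definition locmx (R : realType) n k (theta : {mpoly R[n]})
    (w : momseq R n (2 * k)) :
    'M[R]_(nmon n (loc_deg k theta)) :=
  \matrix_(a, b) riesz (theta * 'X_[mon a] * 'X_[mon b]) w.

Definition mommx (R : realType) n k (w : momseq R n (2 * k)) :=
  locmx 1 w.

(* The index (i, j), (k, l) with i <= k and j <= l stands for the monomial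
   x_i y_j x_k y_l; by [edge_mnm_inj] this parametrization is one-to-one. *)
Definition edge p q :=
  {u : ('I_p * 'I_q) * ('I_p * 'I_q) |
     (u.1.1 <= u.2.1)%N && (u.1.2 <= u.2.2)%N}.

Definition edge_mnm p q (b : edge p q) : 'X_{1..p + q} :=
  let: ((i, j), (k, l)) := val b in
  (U_(lshift q i) + U_(rshift p j) + U_(lshift q k) + U_(rshift p l))%MM.

Definition edge_entries (R : realType) p q (A : 'M[R]_(p * q)) :
    {ffun edge p q -> R} :=
  [ffun b => A (mxtens_index (val b).1) (mxtens_index (val b).2)].

Definition edge_restr (R : realType) p q d (w : momseq R (p + q) d) :
    {ffun edge p q -> R} :=
  [ffun b => mom_at w (edge_mnm b)].

Definition hpolys (R : realType) p q : seq (polyxy R p q) :=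
  [:: (\sum_(i < p) xvar R q i ^+ 2) - 1; (\sum_(j < q) yvar R p j ^+ 2) - 1].

Definition gpolys (R : realType) p q : seq (polyxy R p q) :=
  [:: \sum_(i < p) xvar R q i; \sum_(j < q) yvar R p j].

Record min_problem (R : realType) (V : Type) := MinProblem {
  objective : V -> R;
  feasible : V -> Prop }.

Definition infeasible (R : realType) V (P : min_problem R V) : Prop :=
  ~ exists w : V, feasible P w.

Definition relaxation (R : realType) p q (F : polyxy R p q)
    (a : {ffun edge p q -> R}) (k : nat) :
    min_problem R (momseq R (p + q) (2 * k)) :=
  MinProblem
    (fun w => riesz F w)
    (fun w =>
       [/\ edge_restr w = a,
           forall h, h \in hpolys R p q -> locmx h w = 0,
           psdmx (mommx w) &
           forall g, g \in gpolys R p q -> psdmx (locmx g w)]).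

Lemma mnmU2_inj n (i k i' k' : 'I_n) : (i <= k)%N -> (i' <= k')%N ->
  (U_(i) + U_(k) = U_(i') + U_(k') :> 'X_{1..n})%MM -> i = i' /\ k = k'.
Proof.
move=> ik ik' /mnmP E.
have Ei := E i; have Ek := E k; have Ei' := E i'; have Ek' := E k'.
move: Ei Ek Ei' Ek'; rewrite !mnmDE !mnm1E !eqxx.
rewrite ![k == i]eq_sym ![k' == i']eq_sym.
rewrite ![i' == i]eq_sym ![i' == k]eq_sym ![k' == i]eq_sym ![k' == k]eq_sym.
have [e1|n1] := eqVneq i i'.
  by subst i'; have [-> // | n2] := eqVneq k k'; case: (eqVneq i k); lia.
have [e2|n2] := eqVneq k k'.
  by subst k'; case: (eqVneq i k); case: (eqVneq i' k); lia.
have [e3|n3] := eqVneq i k'; have [e4|n4] := eqVneq i' k.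
- subst k' i'; have e : i = k by apply/val_inj/anti_leq; rewrite ik ik'.
  by rewrite e eqxx in n1.
- by case: (eqVneq i k); case: (eqVneq i' k'); lia.
- by case: (eqVneq i k); case: (eqVneq i' k'); lia.
by case: (eqVneq i k); case: (eqVneq i' k'); lia.
Qed.

Lemma edge_mnm_inj p q : injective (@edge_mnm p q).
Proof.
have lr (i : 'I_p) (j : 'I_q) : (lshift q i == rshift p j) = false.
  by apply/negbTE; rewrite -val_eqE /= neq_ltn ltn_addr.
case=> [[[i j] [k l]] /= b1] [[[i' j'] [k' l']] /= b2].
rewrite /edge_mnm /= => /mnmP E; apply: val_inj => /=.
case/andP: b1 => /= ik jl; case/andP: b2 => /= ik' jl'.
have [-> ->] : i = i' /\ k = k'.
  apply: mnmU2_inj => //; apply/mnmP => a; have := E (lshift q a).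
  by rewrite !mnmDE !mnm1E ![rshift _ _ == _]eq_sym !lr
    !(inj_eq (@lshift_inj _ _)) !addn0.
have [-> ->] // : j = j' /\ l = l'.
apply: mnmU2_inj => //; apply/mnmP => a; have := E (rshift p a).
by rewrite !mnmDE !mnm1E !lr !(inj_eq (@rshift_inj _ _)) !add0n !addn0.
Qed.

Lemma riesz_lincomb (R : realType) n d (w : momseq R n d) (I : finType)
    (c : I -> R) (f : I -> {mpoly R[n]}) :
  riesz (\sum_a c a *: f a) w = \sum_a c a * riesz (f a) w.
Proof.
rewrite /riesz; under [RHS]eq_bigr do rewrite mulr_sumr.
rewrite exchange_big; apply: eq_bigr => m _ /=.
rewrite raddf_sum mulr_suml; apply: eq_bigr => a _.
by rewrite /= mcoeffZ mulrA.
Qed.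

(* [locmx theta w] is the matrix that represents the bilinear form
   (f1, f2) |-> <theta f1 f2, w>, and the only one. *)
Lemma locmxP (R : realType) n k (theta : {mpoly R[n]})
    (w : momseq R n (2 * k)) (L : 'M[R]_(nmon n (loc_deg k theta))) :
  (forall f1 f2 : {mpoly R[n]},
     (msize f1 <= (loc_deg k theta).+1)%N ->
     (msize f2 <= (loc_deg k theta).+1)%N ->
     ((coefvec (loc_deg k theta) f1)^T *m L *m coefvec (loc_deg k theta) f2) 0 0
       = riesz (theta * f1 * f2) w)
  <-> L = locmx theta w.
Proof.
have vX d (a : 'I_(nmon n d)) :
    coefvec d ('X_[mon a] : {mpoly R[n]}) = delta_mx a 0.
  apply/matrixP => i j; rewrite !mxE !ord1 eqxx andbT mcoeffX.
  by rewrite (inj_eq val_inj) (inj_eq enum_val_inj) eq_sym.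
have szX d (a : 'I_(nmon n d)) : (msize ('X_[mon a] : {mpoly R[n]}) <= d.+1)%N.
  by rewrite mmeasureX; apply: bmdeg.
split=> [H | -> f1 f2 sf1 sf2].
  apply/matrixP => a b; rewrite [RHS]mxE -H; try exact: szX.
  by rewrite !vX trmx_delta -rowE -colE !mxE.
have dec d (f : {mpoly R[n]}) : (msize f <= d.+1)%N ->
    f = \sum_(a < nmon n d) f@_(mon a) *: 'X_[mon a].
  move=> sf; rewrite {1}[f](mpolywE sf).
  by rewrite (reindex _ (onW_bij _ (enum_val_bij _))).
rewrite {2}(dec _ f1 sf1) {2}(dec _ f2 sf2) mulr_sumr.
under eq_bigr do rewrite -scalerAr.
rewrite riesz_lincomb mxE; apply: eq_bigr => b _.
rewrite [RHS]mulrC !mxE; congr (_ * _).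
rewrite mulr_sumr mulr_suml.
under [X in riesz X]eq_bigr do rewrite -scalerAr -scalerAl.
by rewrite riesz_lincomb; apply: eq_bigr => a _; rewrite !mxE.
Qed.

(* Main.v *)
(* A separable A is a conic combination of matrices tensmx (x x^T) (y y^T) with
   x, y unit vectors whose signs can be chosen so that both coordinate sums are
   nonnegative; the same combination of point evaluations is feasible at every
   order.

   Conversely, let L be the functional of a feasible w of order k. Its mass
   L(1) is the trace of A. On the product of spheres 1 - z_i^2 is a sum of
   squares, so L = L((1 + z_i) _)/2 + L((1 - z_i) _)/2 splits L into two
   functionals that are still nonnegative on squares, one order lower. The
   potential sum_j L(z_j)^2 / L(1) grows under such a splitting by at least
   Var_i(L)^2 L(1), where Var_i(L) = L(z_i^2)/L(1) - (L(z_i)/L(1))^2, and it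
   never exceeds (p + q) L(1). Hence, after enough splittings, almost all the
   mass sits in functionals of small variance; by Cauchy-Schwarz these are
   close to weighted point evaluations on quartic monomials. So if the
   relaxation is feasible at arbitrarily large orders, A is a limit of sums of
   matrices tensmx (x x^T) (y y^T), and by Caratheodory and compactness it is
   such a sum. *)

Require Import Defs.
From mathcomp Require Import all_boot all_order all_algebra.
From mathcomp Require Import reals.
From mathcomp Require Import mpoly mxtens zify ring lra.

Set Implicit Arguments.
Unset Strict Implicit.
Unset Printing Implicit Defensive.

Import Order.TTheory GRing.Theory Num.Theory.
Local Open Scope ring_scope.

(** * Functionals nonnegative on squares up to a given degree *)

(** A quadratic that stays nonnegative cannot have [c < 0], nor [c = 0] with [b != 0]; for [c > 0]
    its minimum, at [- b / c], gives the bound. *)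
Lemma discriminant_bound (R : realType) (a b c : R) :
  (forall t, 0 <= a + 2 * b * t + c * t ^+ 2) -> b ^+ 2 <= a * c.
Proof.
move=> H; have [c0|c_neq0] := eqVneq c 0.
  have [->|b_neq0] := eqVneq b 0; first by rewrite c0 mulr0 expr0n.
  have := H (- (a + 1) / (2 * b)).
  suff -> : a + 2 * b * (- (a + 1) / (2 * b)) + c * (- (a + 1) / (2 * b)) ^+ 2
    = - 1 by rewrite oppr_ge0 ler10.
  by rewrite c0; field.
have c_gt0 : 0 < c.
  rewrite lt_def c_neq0 leNgt; apply/negP => c_lt0.
  have Hp := H ((`|a| + 2 * `|b| + 1) / (- c) + 1).
  have Hm := H (- ((`|a| + 2 * `|b| + 1) / (- c) + 1)).
  set t := _ + 1 in Hp Hm.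
  have t1 : 1 <= t.
    rewrite lerDr; apply: divr_ge0; last by rewrite oppr_ge0 ltW.
    by do 2!apply: addr_ge0 => //; apply: mulr_ge0.
  have ct : - c * t = `|a| + 2 * `|b| + 1 - c by rewrite /t; field.
  have a_le := ler_norm a.
  have b0 := normr_ge0 b.
  have a0 := normr_ge0 a.
  nra.
rewrite -subr_ge0; have := H (- b / c).
have -> : a + 2 * b * (- b / c) + c * (- b / c) ^+ 2 = (a * c - b ^+ 2) / c.
  by field.
by rewrite pmulr_lge0 ?invr_gt0.
Qed.

Section TruncatedStates.
Variables (R : realType) (n : nat).
Implicit Types (u v f g : {mpoly R[n]}) (L : {mpoly R[n]} -> R).
Variable H : {mpoly R[n]} -> Prop.

Definition linear_functional L : Prop :=
  forall c f g, L (c *: f + g) = c * L f + L g.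

(** The conditions on a moment sequence of order [d], put on a functional on all polynomials so that
    multiplying it by [1 + 'X_i] makes sense. As [msize] is the degree plus one, the multipliers of
    [h] have degree below [d], which suits quadratic constraints. *)
Record truncated_state (d : nat) L : Prop := TruncatedState {
  ts_linear : linear_functional L;
  ts_square : forall u, (msize u <= d.+1)%N -> 0 <= L (u * u);
  ts_ideal : forall h u v, H h -> (msize u <= d)%N -> (msize v <= d)%N ->
    L (h * u * v) = 0 }.

Lemma truncated_state_leq d e L :
  (d <= e)%N -> truncated_state e L -> truncated_state d L.
Proof.
move=> de [Ll Ls Li]; split=> // [u ud|h u v hH ud vd].
  by apply: Ls; apply: leq_trans ud _.
by apply: Li => //; [apply: leq_trans ud _ | apply: leq_trans vd _].
Qed.

Section Linear.
Variable L : {mpoly R[n]} -> R.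
Hypothesis Ll : linear_functional L.

Lemma functional0 : L 0 = 0.
Proof. by have := Ll (-1) 0 0; rewrite scaler0 addr0; lra. Qed.

Lemma functionalD f g : L (f + g) = L f + L g.
Proof. by have := Ll 1 f g; rewrite scale1r mul1r. Qed.

Lemma functionalZ c f : L (c *: f) = c * L f.
Proof. by have := Ll c f 0; rewrite !addr0 functional0 addr0. Qed.

Lemma functionalCM c f : L (c%:MP * f) = c * L f.
Proof. by rewrite mul_mpolyC functionalZ. Qed.

Lemma functionalB f g : L (f - g) = L f - L g.
Proof. by rewrite -scaleN1r functionalD functionalZ mulN1r. Qed.

Lemma functional_sum (I : Type) (r : seq I) (P : pred I)
    (F : I -> {mpoly R[n]}) :
  L (\sum_(i <- r | P i) F i) = \sum_(i <- r | P i) L (F i).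
Proof. by apply: (big_morph L functionalD functional0). Qed.

End Linear.

Lemma msizeMX_le u i d : (msize u <= d)%N -> (msize ('X_i * u)%R <= d.+1)%N.
Proof.
move=> ud; have [->|u0] := eqVneq u 0; first by rewrite mulr0 mmeasure0.
rewrite msizeM // ?msizeX ?mdeg1 //.
by rewrite -(mmeasure_poly_eq0 mdeg) msizeX.
Qed.

Lemma msizeD_leq u v d :
  (msize u <= d)%N -> (msize v <= d)%N -> (msize (u + v)%R <= d)%N.
Proof.
by move=> ud vd; apply: leq_trans (mmeasureD_le _ _ _) _; rewrite geq_max ud.
Qed.

Lemma msizeZ_leq c u d : (msize u <= d)%N -> (msize (c *: u)%R <= d)%N.
Proof. by move=> ud; apply: leq_trans (msizeZ_le _ _) ud. Qed.

Lemma cauchy_schwarz d L u v : truncated_state d L ->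
  (msize u <= d.+1)%N -> (msize v <= d.+1)%N ->
  L (u * v) ^+ 2 <= L (u * u) * L (v * v).
Proof.
case=> Ll Ls _ ud vd; apply: discriminant_bound => t.
have -> : L (u * u) + 2 * L (u * v) * t + L (v * v) * t ^+ 2 =
    L ((u + t *: v) * (u + t *: v)).
  have -> : (u + t *: v) * (u + t *: v)
    = u * u + (2 * t) *: (u * v) + (t ^+ 2) *: (v * v).
    rewrite -!mul_mpolyC rmorphM rmorphXn /= rmorph_nat; ring.
  by rewrite !functionalD // !functionalZ //; ring.
by apply/Ls/msizeD_leq => //; apply: msizeZ_leq.
Qed.

Lemma functional_mul_le d L u v : truncated_state d L ->
  (msize u <= d.+1)%N -> (msize v <= d.+1)%N ->
  `|L (u * v)| <= (L (u * u) + L (v * v)) / 2.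
Proof.
case=> Ll Ls _ ud vd.
have Hp : 0 <= L ((u + v) * (u + v)) by apply/Ls/msizeD_leq.
have Hm : 0 <= L ((u - v) * (u - v)).
  by apply/Ls/msizeD_leq => //; rewrite -scaleN1r; apply: msizeZ_leq.
have Ep : (u + v) * (u + v) = u * u + u * v + u * v + v * v by ring.
have Em : (u - v) * (u - v) = u * u - u * v - u * v + v * v by ring.
move: Hp Hm; rewrite Ep Em !(functionalB Ll, functionalD Ll) => Hp Hm.
by rewrite ler_norml; apply/andP; split; lra.
Qed.

(* Modulo [H], [1 - 'X_i ^+ 2] is a sum of squares; hence so is
   [2 (1 + t) = (1 + t) ^+ 2 + (1 - t ^+ 2)] for [t = 'X_i] and [t = - 'X_i]. *)
Hypothesis bounded_var : forall i : 'I_n,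
  exists (h : {mpoly R[n]}) (J : pred 'I_n),
  H h /\ h = 'X_i * 'X_i + \sum_(j | J j) 'X_j * 'X_j - 1.

(** Under [L], the sphere constraint times [u ^ 2] turns the difference of the two sides into a sum
    of squares [('X_j * u) ^ 2], whose degree costs one order. *)
Lemma var_contraction d L i u : truncated_state d.+1 L -> (msize u <= d.+1)%N ->
  L ('X_i * u * ('X_i * u)) <= L (u * u).
Proof.
case=> Ll Ls Li ud; have [h [J [hH hE]]] := bounded_var i.
have := Li h u u hH ud ud.
have -> : h * u * u = 'X_i * u * ('X_i * u) - u * u
    + \sum_(j | J j) ('X_j * u) * ('X_j * u).
  transitivity ('X_i * u * ('X_i * u) - u * u
    + (\sum_(j | J j) 'X_j * 'X_j) * (u * u)); first by rewrite hE; ring.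
  by rewrite mulr_suml; congr (_ + _); apply: eq_bigr => j _; ring.
rewrite functionalD // functionalB // functional_sum // => E.
suff : 0 <= \sum_(j | J j) L ('X_j * u * ('X_j * u)) by lra.
by apply: sumr_ge0 => j _; apply/Ls/msizeMX_le.
Qed.

(** For a measure, reweighting by the density [(1 + t) / 2]; the densities for [t = 'X_i] and
    [t = - 'X_i] add up to 1. *)
Definition half_shift (t : {mpoly R[n]}) L f : R := L ((1 + t) * f) / 2.

Lemma half_shift_state d L i t : t = 'X_i \/ t = - 'X_i ->
  truncated_state d.+1 L -> truncated_state d (half_shift t L).
Proof.
move=> tE tsL; have [Ll Ls Li] := tsL.
have tt : t * t = 'X_i * 'X_i by case: tE => ->; ring.
have szt m u : (msize u <= m)%N -> (msize ((1 + t) * u) <= m.+1)%N.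
  move=> um; rewrite mulrDl mul1r; apply: msizeD_leq; first exact: leqW.
  case: tE => ->; first exact: msizeMX_le.
  by rewrite mulNr -scaleN1r; apply/msizeZ_leq/msizeMX_le.
rewrite /half_shift; split=> [c f g|u ud|h u v hH ud vd].
- by rewrite mulrDr -scalerAr Ll; ring.
- have := var_contraction i tsL ud; have := Ls _ (szt _ _ ud).
  suff E : L ((1 + t) * (u * u)) + L ((1 + t) * (u * u)) =
      L ((1 + t) * u * ((1 + t) * u)) + (L (u * u) - L ('X_i * u * ('X_i * u))).
    by lra.
  rewrite -functionalB // -!functionalD //; congr L.
  rewrite (_ : 'X_i * u * ('X_i * u) = t * t * (u * u));
    last by rewrite tt; ring.
  by ring.
- have -> : (1 + t) * (h * u * v) = h * ((1 + t) * u) * v by ring.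
  by rewrite Li ?mul0r //; [apply: szt | apply: leqW].
Qed.

Lemma msize_prod_var (s : seq 'I_n) :
  (msize (\prod_(i <- s) 'X_i : {mpoly R[n]}) <= (size s).+1)%N.
Proof.
elim: s => [|i s IH]; first by rewrite big_nil msize1.
by rewrite big_cons; apply: msizeMX_le.
Qed.

Lemma prod_var_square_le d L (s : seq 'I_n) :
  truncated_state d L -> (size s <= d)%N ->
  L ((\prod_(i <- s) 'X_i) * (\prod_(i <- s) 'X_i)) <= L 1.
Proof.
move=> tsL; elim: s => [|i s IH] sd; first by rewrite big_nil mulr1.
rewrite big_cons; case: d => // d in sd tsL IH *.
apply: le_trans (var_contraction i tsL _) (IH (ltnW sd)).
exact: leq_trans (msize_prod_var _) sd.
Qed.

Definition quartic (i j k l : 'I_n) : {mpoly R[n]} :=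
  'X_i * 'X_j * ('X_k * 'X_l).

Lemma quartic_bound d L i j k l : truncated_state d.+2 L ->
  `|L (quartic i j k l)| <= L 1.
Proof.
move=> tsL.
have E2 a b : \prod_(c <- [:: a; b]) 'X_c = 'X_a * 'X_b :> {mpoly R[n]}.
  by rewrite big_cons big_seq1.
have B a b := @prod_var_square_le _ L [:: a; b] tsL isT.
have S a b : (msize ('X_a * 'X_b : {mpoly R[n]}) <= d.+3)%N.
  by rewrite -E2; apply: leq_trans (msize_prod_var _) _.
apply: le_trans (functional_mul_le tsL (S i j) (S k l)) _.
have := B i j; have := B k l; rewrite !E2; lra.
Qed.

Lemma mean_square_le d L i : truncated_state d.+1 L ->
  L 'X_i ^+ 2 <= L 1 * L ('X_i * 'X_i) /\ L ('X_i * 'X_i) <= L 1.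
Proof.
move=> tsL; split.
  have /= := cauchy_schwarz (u := 1) (v := 'X_i) tsL.
  by rewrite !mul1r msize1 msizeX mdeg1; apply.
have := @prod_var_square_le _ L [:: i] tsL isT.
by rewrite !big_seq1.
Qed.

Lemma mass_ge0 d L : truncated_state d L -> 0 <= L 1.
Proof.
by move=> tsL; have := ts_square tsL (u := 1); rewrite mulr1 msize1; apply.
Qed.

(** For a measure, the mass times the squared norm of the barycentre. Where [L 1 = 0], division by
    zero makes it 0. *)
Definition potential L : R := \sum_i L 'X_i ^+ 2 / L 1.

Lemma potential_le d L : truncated_state d.+1 L -> potential L <= n%:R * L 1.
Proof.
move=> tsL; rewrite mulr_natl -[X in _ *+ X]card_ord -sumr_const.
apply: ler_sum => i _; have [m0|m0] := eqVneq (L 1) 0.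
  by rewrite m0 invr0 mulr0.
have m_gt0 : 0 < L 1 by rewrite lt_def m0 (mass_ge0 tsL).
rewrite ler_pdivrMr //; have [h1 h2] := mean_square_le i tsL.
by apply: le_trans h1 _; rewrite ler_wpM2l // ltW.
Qed.

Lemma half_shift_mean i L f : linear_functional L ->
  half_shift 'X_i L f = (L f + L ('X_i * f)) / 2 /\
  half_shift (- 'X_i) L f = (L f - L ('X_i * f)) / 2.
Proof.
move=> Ll; rewrite /half_shift; split; congr (_ / 2).
  by rewrite mulrDl mul1r functionalD.
by rewrite mulrDl mul1r mulNr functionalB.
Qed.

(** Splitting along ['X_i] adds to the [j]-th term a nonnegative multiple of the squared covariance
    of ['X_i] and ['X_j]. Only [j = i] is kept, where [bad] bounds the covariance from below. *)
Lemma potential_gain d L i (e : R) : truncated_state d.+2 L -> 0 <= e ->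
  e * L 1 ^+ 2 < L 1 * L ('X_i * 'X_i) - L 'X_i ^+ 2 ->
  potential L + e ^+ 2 * L 1 <=
    potential (half_shift 'X_i L) + potential (half_shift (- 'X_i) L).
Proof.
move=> tsL e0 bad; have Ll := ts_linear tsL.
have [h1 h2] := mean_square_le i tsL; have m_ge0 := mass_ge0 tsL.
have m_gt0 : 0 < L 1.
  rewrite lt_def m_ge0 andbT; apply/eqP => m0; move: bad.
  by rewrite m0 expr0n mulr0 mul0r; have := sqr_ge0 (L 'X_i); lra.
set m := L 1 in bad h1 h2 m_ge0 m_gt0 *; set a := L 'X_i in bad h1.
have am : a ^+ 2 < m ^+ 2.
  have : m * L ('X_i * 'X_i) <= m ^+ 2 by rewrite expr2 ler_wpM2l.
  have : 0 <= e * m ^+ 2 by rewrite mulr_ge0 ?sqr_ge0.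
  lra.
(* The halves have masses [(m + a) / 2] and [(m - a) / 2], so no division below is by zero. *)
have ma : 0 < m - a /\ 0 < m + a by nra.
have [ma1 ma2] := ma.
have gain j : let b := L 'X_j in let c := L ('X_i * 'X_j) in
    ((b + c) / 2) ^+ 2 / ((m + a) / 2) + ((b - c) / 2) ^+ 2 / ((m - a) / 2)
    = b ^+ 2 / m + (m * c - a * b) ^+ 2 / (m * ((m - a) * (m + a))).
  by move=> b c; field; rewrite !gt_eqF.
have -> : potential (half_shift 'X_i L) + potential (half_shift (- 'X_i) L)
  = potential L + \sum_j (m * L ('X_i * 'X_j) - a * L 'X_j) ^+ 2
      / (m * ((m - a) * (m + a))).
  rewrite -!big_split /=; apply: eq_bigr => j _; rewrite -gain.
  have [-> ->] := half_shift_mean i 'X_j Ll.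
  by have [-> ->] := half_shift_mean i 1 Ll; rewrite mulr1.
rewrite lerD2l (bigD1 i) //= -[leLHS]addr0; apply: lerD.
  rewrite ler_pdivlMr ?mulr_gt0 //.
  set v := _ - a * _ in bad *;
  have ve : (e * m ^+ 2) ^+ 2 <= v ^+ 2.
    have em0 : 0 <= e * m ^+ 2 by rewrite mulr_ge0 ?sqr_ge0.
    rewrite ler_pXn2r ?nnegrE //; last by apply: le_trans (ltW bad).
    by rewrite ltW.
  apply: le_trans ve; rewrite -subr_ge0.
  have -> : (e * m ^+ 2) ^+ 2 - e ^+ 2 * m * (m * ((m - a) * (m + a)))
     = (e * m * a) ^+ 2 by ring.
  exact: sqr_ge0.
apply: sumr_ge0 => j _; apply: divr_ge0; first exact: sqr_ge0.
by rewrite ltW // !mulr_gt0.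
Qed.

(** * Functionals of small variance and approximation by point evaluations *)

Definition spread_le (e : R) L : Prop :=
  forall i, L 1 * L ('X_i * 'X_i) - L 'X_i ^+ 2 <= e ^+ 2 * L 1 ^+ 2.

(** The four variables are replaced by their means one after the other. By Cauchy-Schwarz each of
    the first three replacements costs at most [e * L 1]; the last is free, since [L] vanishes on
    ['X_l] minus its mean. Products of up to three variables occur, hence order 3. *)
Lemma quartic_concentration L (e : R) : truncated_state 3 L -> 0 <= e ->
  spread_le e L -> forall i j k l,
  `|L (quartic i j k l) - L 1 * (L 'X_i / L 1 * (L 'X_j / L 1)
       * (L 'X_k / L 1 * (L 'X_l / L 1)))| <= 3 * e * L 1.
Proof.
move=> tsL e0 spr i j k l; have Ll := ts_linear tsL.
have m_ge0 := mass_ge0 tsL.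
have [m0|m_neq0] := eqVneq (L 1) 0.
  by have := quartic_bound i j k l tsL; rewrite m0 mul0r mulr0 subr0.
have m_gt0 : 0 < L 1 by rewrite lt_def m_neq0.
have [c cE] : exists c, forall a, c a = L 'X_a / L 1.
  by exists (fun a => L 'X_a / L 1).
rewrite -!cE.
have c_le1 a : `|c a| <= 1.
  have [h1 h2] := mean_square_le a tsL.
  rewrite cE normrM normfV (ger0_norm m_ge0) ler_pdivrMr // mul1r.
  rewrite -(@ler_pXn2r _ 2) ?nnegrE // real_normK ?num_real //.
  by apply: le_trans h1 _; rewrite expr2 ler_wpM2l.
have dev a (s : seq 'I_n) : (size s <= 3)%N ->
    `|L (('X_a - (c a)%:MP) * \prod_(b <- s) 'X_b)| <= e * L 1.
  move=> s3; rewrite -(@ler_pXn2r _ 2) ?nnegrE ?mulr_ge0 //.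
  rewrite real_normK ?num_real //.
  apply: le_trans (cauchy_schwarz tsL _ _) _.
  - apply: msizeD_leq; first by rewrite msizeX mdeg1.
    by rewrite mmeasureN mmeasureC; case: (c a == 0).
  - by apply: leq_trans (msize_prod_var _) _.
  have -> : (e * L 1) ^+ 2 = e ^+ 2 * L 1 * L 1 by ring.
  have V : L (('X_a - (c a)%:MP) * ('X_a - (c a)%:MP)) <= e ^+ 2 * L 1.
    have -> : ('X_a - (c a)%:MP) * ('X_a - (c a)%:MP) = 'X_a * 'X_a
      - (2 * c a) *: 'X_a + (c a ^+ 2) *: 1 :> {mpoly R[n]}.
      rewrite -!mul_mpolyC rmorphM rmorphXn /= rmorph_nat; ring.
    rewrite functionalD // functionalB // !functionalZ //.
    rewrite -(ler_pM2l m_gt0).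
    have -> : L 1 * (L ('X_a * 'X_a) - 2 * c a * L 'X_a + c a ^+ 2 * L 1)
      = L 1 * L ('X_a * 'X_a) - L 'X_a ^+ 2 by rewrite cE; field.
    by rewrite mulrCA -expr2; apply: spr.
  apply: ler_pM => //.
  - apply: (ts_square tsL); apply: msizeD_leq; first by rewrite msizeX mdeg1.
    by rewrite mmeasureN mmeasureC; case: (c a == 0).
  - by apply: (ts_square tsL); apply: leq_trans (msize_prod_var _) _.
  exact: prod_var_square_le tsL s3.
have d1 := dev i [:: j; k; l] isT; have d2 := dev j [:: k; l] isT.
have d3 := dev k [:: l] isT.
rewrite !big_cons !big_nil !mulr1 in d1 d2 d3.
have c4 : L ('X_l - (c l)%:MP) = 0.
  rewrite functionalB // -[(c l)%:MP]mulr1 functionalCM // cE.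
  by field.
have -> : quartic i j k l = ('X_i - (c i)%:MP) * ('X_j * ('X_k * 'X_l))
   + (c i)%:MP * (('X_j - (c j)%:MP) * ('X_k * 'X_l))
   + (c i)%:MP * ((c j)%:MP * (('X_k - (c k)%:MP) * 'X_l))
   + (c i)%:MP * ((c j)%:MP * ((c k)%:MP * ('X_l - (c l)%:MP)))
   + (c i)%:MP * ((c j)%:MP * ((c k)%:MP * ((c l)%:MP * 1))).
  by rewrite /quartic; ring.
rewrite !functionalD // !functionalCM // c4.
have -> (x y z m : R) : x + c i * y + c i * (c j * z) + c i * (c j * (c k * 0))
    + c i * (c j * (c k * (c l * m))) - m * (c i * c j * (c k * c l))
    = x + c i * y + c i * (c j * z) by ring.
have shrink a x : `|x| <= e * L 1 -> `|c a * x| <= e * L 1.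
  move=> xe; rewrite normrM -[leRHS]mul1r; exact: ler_pM.
have {d2}d2 := shrink i _ d2.
have {d3}d3 := shrink i _ (shrink j _ d3).
apply: le_trans (ler_normD _ _) _.
have := ler_normD (L (('X_i - (c i)%:MP) * ('X_j * ('X_k * 'X_l))))
  (c i * L (('X_j - (c j)%:MP) * ('X_k * 'X_l))).
by lra.
Qed.

Lemma half_shift_split i L : linear_functional L ->
  forall f, L f = half_shift 'X_i L f + half_shift (- 'X_i) L f.
Proof. by move=> Ll f; have [-> ->] := half_shift_mean i f Ll; field. Qed.

(* Split along any coordinate of large variance: each split raises the potential
   of the part being split, so after [N] rounds the mass [r] of the parts still
   spread out is at most [n L(1) / (N e^4)]. *)
Lemma quartic_approximation N L (e : R) : 0 <= e -> truncated_state (N + 3) L ->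
  exists (s : seq (R * ('I_n -> R))) (r : R),
  [/\ all (fun z => 0 <= z.1) s, 0 <= r <= L 1,
      N%:R * e ^+ 4 * r <= n%:R * L 1 - potential L &
      forall i j k l, `|L (quartic i j k l)
        - \sum_(z <- s) z.1 * (z.2 i * z.2 j * (z.2 k * z.2 l))|
        <= 3 * e * L 1 + r].
Proof.
move=> e0; elim: N L => [|N IH] L tsL.
  exists [::], (L 1); split=> //; first by rewrite (mass_ge0 tsL) lexx.
    by rewrite !mul0r subr_ge0 (potential_le tsL).
  move=> i j k l; rewrite big_nil subr0.
  apply: le_trans (quartic_bound i j k l tsL) _.
  by rewrite lerDr !mulr_ge0 // (mass_ge0 tsL).
have m_ge0 := mass_ge0 tsL.
have ts3 : truncated_state 3 L by apply: truncated_state_leq tsL; lia.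
case: (boolP [forall i,
    L 1 * L ('X_i * 'X_i) - L 'X_i ^+ 2 <= e ^+ 2 * L 1 ^+ 2]).
  (* All variances are small: one atom at the barycentre carries the whole mass. *)
  move=> /forallP spr; exists [:: (L 1, fun i => L 'X_i / L 1)], 0; split.
  - by rewrite /= m_ge0.
  - by rewrite lexx.
  - by rewrite mulr0 subr_ge0 (potential_le ts3).
  - by move=> i j k l; rewrite big_seq1 addr0; apply: quartic_concentration.
rewrite negb_forall => /existsP[i]; rewrite -ltNge => bad.
have tsL' : truncated_state (N + 3).+1 L by [].
have gain : potential L + e ^+ 4 * L 1 <=
    potential (half_shift 'X_i L) + potential (half_shift (- 'X_i) L).
  rewrite (_ : e ^+ 4 = (e ^+ 2) ^+ 2); last by rewrite -exprM.
  apply: (potential_gain (d := N.+2)) bad; last exact: sqr_ge0.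
  by apply: truncated_state_leq tsL; lia.
have [s1 [r1 [s1p /andP[r1p r1m] pot1 ap1]]] :=
  IH _ (half_shift_state (i := i) (t := 'X_i) (or_introl erefl) tsL').
have [s2 [r2 [s2p /andP[r2p r2m] pot2 ap2]]] :=
  IH _ (half_shift_state (i := i) (t := - 'X_i) (or_intror erefl) tsL').
have split1 := half_shift_split i (ts_linear tsL).
exists (s1 ++ s2), (r1 + r2); split.
- by rewrite all_cat s1p.
- by rewrite addr_ge0 // split1 lerD.
(* The bounds for the halves and [gain] together leave [e ^ 4 * L 1] to spare, which pays for one
   more [e ^ 4 * r]. *)
- have rm : e ^+ 4 * (r1 + r2) <= e ^+ 4 * L 1.
    by rewrite ler_wpM2l ?exprn_ge0 // split1 lerD.
  rewrite -natr1; have := split1 1; nra.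
- move=> a b c d; rewrite big_cat /=.
  rewrite [L (quartic _ _ _ _)]split1 [L 1]split1 opprD addrACA.
  apply: le_trans (ler_normD _ _) _; have := ap1 a b c d; have := ap2 a b c d.
  lra.
Qed.

End TruncatedStates.
(** * Closedness of the cone of sums of product matrices *)

(** More than [m * n] matrices are linearly dependent; subtracting a multiple of the dependency from
    their coefficients kills one of them and keeps the others nonnegative. Shorter families are
    padded with zeros. *)
Lemma conic_caratheodory (R : realFieldType) (m n : nat)
    (P : 'M[R]_(m, n) -> Prop) :
  (forall c M, 0 <= c -> P M -> P (c *: M)) -> (exists M, P M) ->
  forall (N : nat) (M : 'I_N -> 'M[R]_(m, n)), (forall s, P (M s)) ->
  exists M' : 'I_(m * n) -> 'M[R]_(m, n),
    (forall s, P (M' s)) /\ \sum_s M' s = \sum_s M s.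
Proof.
move=> Pscale [M0 PM0]; have P0 : P 0 by rewrite -(scale0r M0); apply: Pscale.
elim=> [|N IH] M PM.
  by exists (fun=> 0); split=> //; rewrite big_ord0 big1.
have [lt_N_mn|le_mn_N] := ltnP N (m * n)%N.
  pose ext (k : 'I_(m * n)) := oapp M 0 (insub (k : nat) : option 'I_N.+1).
  exists ext; split=> [k|]; first by rewrite /ext; case: insubP => /=.
  have -> : \sum_s M s = \sum_(k < N.+1) oapp M 0 (insub (val k)).
    by apply: eq_bigr => k _; rewrite valK.
  rewrite (big_ord_widen _ (fun k => oapp M 0 (insub k)) lt_N_mn).
  rewrite [LHS](bigID (fun k : 'I_(m * n) => (k < N.+1)%N)) /= [X in _ + X]big1.
    by rewrite addr0; apply: eq_bigl => k.
  by move=> k kN; rewrite /ext insubN.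
pose V := \matrix_(s < N.+1) mxvec (M s).
have [a aV [s0 a0]] : exists2 a : 'rV[R]_N.+1, a *m V = 0 & exists s, 0 < a 0 s.
  have : kermx V != 0.
    rewrite -mxrank_eq0 mxrank_ker subn_eq0 -ltnNge ltnS.
    exact: leq_trans (rank_leq_col _) le_mn_N.
  case/rowV0Pn=> a /sub_kermxP aV /rV0Pn[s].
  case: (ltgtP (a 0 s) 0) => // as0 _; last by exists a => //; exists s.
  exists (- a); first by rewrite mulNmx aV oppr0.
  by exists s; rewrite mxE oppr_gt0.
have sumaM : \sum_s a 0 s *: M s = 0.
  apply: (can_inj mxvecK); transitivity (a *m V); last by rewrite aV linear0.
  rewrite linear_sum mulmx_sum_row.
  by apply: eq_bigr => s _; rewrite linearZ rowK.
(* Dividing by the largest coefficient makes every [1 - a 0 s / a 0 s1] nonnegative, and zero at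
   [s1]. *)
case: (arg_maxP (fun s => a 0 s) (erefl true : predT s0)) => s1 _ max_s1.
have a1 : 0 < a 0 s1 by apply: lt_le_trans a0 (max_s1 _ _).
have [|M' [PM' sumM']] :=
    IH (fun s => (1 - a 0 (lift s1 s) / a 0 s1) *: M (lift s1 s)).
  move=> s; apply: Pscale => //.
  by rewrite subr_ge0 ler_pdivrMr // mul1r; apply: max_s1.
exists M'; split=> //; rewrite sumM'.
have -> : \sum_s M s = \sum_s (1 - a 0 s / a 0 s1) *: M s.
  under [RHS]eq_bigr do rewrite scalerBl scale1r mulrC -scalerA.
  by rewrite sumrB -scaler_sumr sumaM scaler0 subr0.
by rewrite (bigD1_ord s1) //= divff ?gt_eqF // subrr scale0r add0r.
Qed.

(* [y] is the limit superior of the [x] with [P e x] as [e] tends to 0. *)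
Lemma cluster_point (R : realType) (B : R) (P : R -> R -> Prop) :
  (forall e e' x, e <= e' -> P e x -> P e' x) ->
  (forall e, 0 < e -> exists2 x, `|x| <= B & P e x) ->
  exists y, forall e, 0 < e -> exists2 x, `|x - y| <= e & P e x.
Proof.
move=> Pmono Pex.
pose S t := forall e, 0 < e -> exists2 x, t <= x <= B & P e x.
have S_B : S (- B).
  move=> e /Pex[x xB Px]; exists x => //.
  by move: xB; rewrite ler_norml.
have S_ub t : S t -> t <= B.
  by move=> /(_ 1 ltr01)[x /andP[tx xB] _]; apply: le_trans tx xB.
have supS : classical_sets.has_sup S.
  by split; [exists (- B) | exists B; exact: S_ub].
exists (sup S) => e e0; apply: boolp.contrapT => far.
(* If no suitable [x] is within [e] of the supremum, those above a nearby [t] in [S] lie beyond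
   [sup S + e], which then belongs to [S]. *)
suff /(ub_le_sup (proj2 supS)) : S (sup S + e) by lra.
have [t St te] := sup_adherent e0 supS.
move=> e1 e1_gt0; have [|x /andP[tx xB] Px] := St (Order.min e e1).
  by rewrite lt_min e0.
exists x; last by apply: Pmono Px; rewrite ge_min lexx orbT.
rewrite xB andbT leNgt; apply/negP => xe; apply: far; exists x.
  by rewrite ler_norml; lra.
by apply: Pmono Px; rewrite ge_min lexx.
Qed.

(** The coordinates are settled one at a time: the condition passed to [cluster_point] keeps the
    earlier ones near their limits, in place of nested subsequences. *)
Lemma cluster_family (R : realType) (J : finType) (B : R)
    (P : R -> (J -> R) -> Prop) :
  (forall e e' x, e <= e' -> P e x -> P e' x) ->
  (forall e, 0 < e -> exists2 x, (forall j, `|x j| <= B) & P e x) ->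
  exists y : J -> R, (forall e, 0 < e ->
    exists2 x, forall j, `|x j - y j| <= e /\ `|x j| <= B & P e x).
Proof.
move=> Pmono Pex.
suff [y Hy] : exists y : J -> R, forall e, 0 < e -> exists x,
    [/\ forall j, `|x j| <= B, P e x &
        forall j, j \in enum J -> `|x j - y j| <= e].
  exists y => e /Hy[x [xB Px xy]]; exists x => // j; split=> //.
  by apply: xy; rewrite mem_enum.
elim: (enum J) => [|j s [y Hy]].
  by exists (fun=> 0) => e /Pex[x xB Px]; exists x.
have [||z Hz] := @cluster_point R B (fun e t => exists x,
    [/\ forall i, `|x i| <= B, P e x, x j = t &
        forall i, i \in s -> `|x i - y i| <= e]).
- move=> e e' t ee' [x [xB Px xj xs]]; exists x; split=> //.
    exact: Pmono Px.
  by move=> i /xs xi; apply: le_trans xi ee'.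
- by move=> e /Hy[x [xB Px xs]]; exists (x j) => //; exists x.
exists (fun i => if i == j then z else y i) => e /Hz[t tz [x [xB Px xj xs]]].
exists x; split=> // i; rewrite inE; case: eqP => [-> _|_ /xs //].
by rewrite xj.
Qed.

(** * Products of rank-one matrices and limits of their sums *)

Definition prod_mx (R : realType) p q (x : 'I_p -> R) (y : 'I_q -> R) :
    'M[R]_(p * q) :=
  tensmx (\matrix_(i, k) (x i * x k)) (\matrix_(j, l) (y j * y l)).

Lemma prod_mxE (R : realType) p q (x : 'I_p -> R) (y : 'I_q -> R) i j k l :
  prod_mx x y (mxtens_index (i, j)) (mxtens_index (k, l)) =
  x i * x k * (y j * y l).
Proof. by rewrite tensmxE !mxE. Qed.

Lemma prod_mxZ (R : realType) p q (c d : R) (x : 'I_p -> R) (y : 'I_q -> R) :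
  prod_mx (fun i => c * x i) (fun j => d * y j) = (c * d) ^+ 2 *: prod_mx x y.
Proof.
apply/matrixP => a b.
case: (mxtens_indexP a) => i j; case: (mxtens_indexP b) => k l.
by rewrite [RHS]mxE !prod_mxE; ring.
Qed.

Definition norm2 (R : realType) n (x : 'I_n -> R) : R :=
  Num.sqrt (\sum_i x i ^+ 2).

Section Norm2.
Variables (R : realType) (n : nat).
Implicit Type x : 'I_n -> R.

Lemma norm2_ge0 x : 0 <= norm2 x.
Proof. exact: sqrtr_ge0. Qed.

Lemma norm2_sqr x : norm2 x ^+ 2 = \sum_i x i ^+ 2.
Proof.
by rewrite /norm2 sqr_sqrtr //; apply: sumr_ge0 => i _; apply: sqr_ge0.
Qed.

Lemma le_norm2 x i : `|x i| <= norm2 x.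
Proof.
rewrite -(@ler_pXn2r _ 2) ?nnegrE ?norm2_ge0 // norm2_sqr.
rewrite real_normK ?num_real //.
by rewrite (bigD1 i) //= lerDl; apply: sumr_ge0 => j _; apply: sqr_ge0.
Qed.

Lemma norm2_unit x i : norm2 x * (x i / norm2 x) = x i.
Proof.
have [n0|n0] := eqVneq (norm2 x) 0; last by field.
by have := le_norm2 x i; rewrite n0 normr_le0 mul0r => /eqP.
Qed.

Lemma norm2_unit1 x : norm2 x != 0 -> \sum_i (x i / norm2 x) ^+ 2 = 1.
Proof.
move=> n0; under eq_bigr do rewrite expr_div_n.
by rewrite -mulr_suml -norm2_sqr divff // sqrf_eq0.
Qed.

End Norm2.

Section ProductMatrices.
Variables (R : realType) (p q : nat).
Implicit Types (x : 'I_p -> R) (y : 'I_q -> R) (A : 'M[R]_(p * q)).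

(* With the whole scale carried by the first factor, the trace bounds both. *)
Lemma prod_mx_normalize x y :
  prod_mx x y = prod_mx (fun i => norm2 y * x i) (fun j => y j / norm2 y).
Proof.
apply/matrixP => a b.
case: (mxtens_indexP a) => i j; case: (mxtens_indexP b) => k l.
rewrite !prod_mxE -{1}[y j]norm2_unit -{1}[y l]norm2_unit; ring.
Qed.

Lemma mxtrace_tens A :
  \tr A = \sum_i \sum_j A (mxtens_index (i, j)) (mxtens_index (i, j)).
Proof.
rewrite /mxtrace (reindex (@mxtens_index p q)) /=; last first.
  exists (@mxtens_unindex p q) => a _; first exact: mxtens_indexK.
  exact: mxtens_unindexK.
by rewrite pair_bigA /=; apply: eq_bigr => -[i j].
Qed.

Lemma trace_prod_mx x y : \tr (prod_mx x y) = norm2 x ^+ 2 * norm2 y ^+ 2.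
Proof.
rewrite mxtrace_tens !norm2_sqr mulr_suml; apply: eq_bigr => i _.
by rewrite mulr_sumr; apply: eq_bigr => j _; rewrite prod_mxE !expr2.
Qed.

Lemma trace_prod_mx_ge0 x y : 0 <= \tr (prod_mx x y).
Proof. by rewrite trace_prod_mx mulr_ge0 ?sqr_ge0. Qed.

Lemma normM_dist (C D u u' v v' : R) :
  `|v| <= C -> `|u'| <= C -> `|u - u'| <= D -> `|v - v'| <= D ->
  `|u * v - u' * v'| <= 2 * C * D.
Proof.
move=> vC uC uD vD.
rewrite (_ : u * v - u' * v' = (u - u') * v + u' * (v - v')); last by ring.
apply: le_trans (ler_normD _ _) _; rewrite !normrM.
have := ler_pM (normr_ge0 _) (normr_ge0 _) uD vC.
have := ler_pM (normr_ge0 _) (normr_ge0 _) uC vD.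
lra.
Qed.

Lemma prod_mx_dist (C e : R) x x' y y' :
  (forall i, `|x i| <= C) -> (forall i, `|x' i| <= C) ->
  (forall j, `|y j| <= C) -> (forall j, `|y' j| <= C) ->
  (forall i, `|x i - x' i| <= e) -> (forall j, `|y j - y' j| <= e) ->
  forall a b, `|prod_mx x y a b - prod_mx x' y' a b| <= 4 * C ^+ 3 * e.
Proof.
move=> xC xC' yC yC' xe ye a b.
case: (mxtens_indexP a) => i j; case: (mxtens_indexP b) => k l.
rewrite !prod_mxE.
rewrite (_ : 4 * C ^+ 3 * e = 2 * (C * C) * (2 * C * e)); last by ring.
apply: normM_dist; rewrite ?normrM; try exact: ler_pM; exact: normM_dist.
Qed.

(** Caratheodory bounds the number of summands and, once they are normalized, the trace bounds their
    parameters [z]. These stay in a fixed box, and at a cluster point the representation is exact by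
    continuity. *)
Lemma prod_mx_sum_closed A :
  (forall e, 0 < e ->
    exists (N : nat) (x : 'I_N -> 'I_p -> R) (y : 'I_N -> 'I_q -> R),
    forall a b, `|A a b - (\sum_s prod_mx (x s) (y s)) a b| <= e) ->
  exists (N : nat) (x : 'I_N -> 'I_p -> R) (y : 'I_N -> 'I_q -> R),
    A = \sum_s prod_mx (x s) (y s).
Proof.
move=> approx; pose D := ((p * q) * (p * q))%N.
pose S (z : 'I_D * ('I_p + 'I_q) -> R) :=
  \sum_s prod_mx (fun i => z (s, inl i)) (fun j => z (s, inr j)).
pose P e z := forall a b, `|A a b - S z a b| <= e.
(* An approximation within 1 has trace at most [\tr A + (p * q)%:R], which bounds the squared
   coordinates of the first factors; the second factors are unit or zero vectors. *)
pose B := 1 + `|\tr A + (p * q)%:R|.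
have B1 : 1 <= B by rewrite lerDl.
have [||z Hz] := @cluster_family R _ B P.
- by move=> e e' z ee' Pz a b; apply: le_trans (Pz a b) ee'.
- move=> e e0; have [|N [x [y Axy]]] := approx (Order.min e 1).
    by rewrite lt_min e0 ltr01.
  have [|||M [MP sumM]] := @conic_caratheodory R _ _
    (fun M : 'M[R]_(p * q) => exists x y, M = prod_mx x y) _ _ N
    (fun s => prod_mx (x s) (y s)).
  - move=> c _ c0 [u [v ->]].
    exists (fun i => Num.sqrt c * u i), (fun j => 1 * v j).
    by rewrite prod_mxZ mulr1 sqr_sqrtr.
  - by exists (prod_mx (fun=> 0) (fun=> 0)), (fun=> 0), (fun=> 0).
  - by move=> s; exists (x s), (y s).
  have [u Hu] := boolp.choice MP; have [v Hv] := boolp.choice Hu.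
  pose z (k : 'I_D * ('I_p + 'I_q)) := match k.2 with
    | inl i => norm2 (v k.1) * u k.1 i | inr j => v k.1 j / norm2 (v k.1) end.
  have Sz : S z = \sum_s prod_mx (x s) (y s).
    rewrite -sumM /S; apply: eq_bigr => s _.
    by rewrite Hv [RHS]prod_mx_normalize.
  exists z; last by move=> a b; rewrite Sz (le_trans (Axy a b)) // ge_min lexx.
  case=> s [i|j]; rewrite /z /=; last first.
    apply: le_trans B1; rewrite normrM normfV (ger0_norm (norm2_ge0 _)).
    have [->|n0] := eqVneq (norm2 (v s)) 0; first by rewrite invr0 mulr0.
    by rewrite ler_pdivrMr ?mul1r ?le_norm2 // lt_def n0 norm2_ge0.
  have le_tr : (norm2 (v s) * u s i) ^+ 2 <= \tr A + (p * q)%:R.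
    apply: (@le_trans _ _ (\tr (\sum_s prod_mx (x s) (y s)))).
      rewrite -sumM raddf_sum (bigD1 s) //= Hv trace_prod_mx.
      rewrite exprMn mulrC -[leLHS]addr0; apply: lerD.
        rewrite ler_wpM2r ?sqr_ge0 //.
        rewrite -[leLHS]real_normK ?num_real // ler_pXn2r ?nnegrE ?norm2_ge0 //.
        exact: le_norm2.
      by apply: sumr_ge0 => k _; rewrite Hv trace_prod_mx_ge0.
    rewrite /mxtrace -lerBlDl -sumrB -[X in X%:R]card_ord -sumr_const.
    apply: ler_sum => a _.
    have := Axy a a; rewrite le_min => /andP[_].
    by rewrite ler_norml => /andP[]; lra.
  rewrite -(@ler_pXn2r _ 2) ?nnegrE //; last by rewrite (le_trans ler01).
  rewrite real_normK ?num_real //; apply: le_trans le_tr _.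
  rewrite /B; set T := _ + _%:R; have := ler_norm T; have := normr_ge0 T; nra.
exists D, (fun s i => z (s, inl i)), (fun s j => z (s, inr j)); rewrite -/(S z).
apply/matrixP => a b; apply/eqP; rewrite -subr_eq0 -normr_le0.
(* [4 * (B + 1) ^ 3] is a Lipschitz constant of one summand on the box of radius [B + 1], and the
   leading 1 stands for the error in [P]. The cap 1 on the distance below keeps [z] in that box. *)
pose K := 1 + D%:R * (4 * (B + 1) ^+ 3).
have K0 : 0 < K by rewrite ltr_wpDr // !mulr_ge0 ?exprn_ge0 // addr_ge0 //; lra.
apply/ler_addgt0Pr => e e0; rewrite add0r.
have [|w wz Pw] := Hz (Order.min (e / K) 1).
  by rewrite lt_min divr_gt0 ?ltr01.
set d := Order.min _ _ in wz Pw.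
have d1 : d <= 1 by rewrite /d ge_min lexx orbT.
have de : d * K <= e by rewrite -ler_pdivlMr // /d ge_min lexx.
have wzd k : `|w k - z k| <= d by have [] := wz k.
have wC k : `|w k| <= B + 1 by have [_] := wz k; lra.
have zC k : `|z k| <= B + 1.
  have [h1 h2] := wz k; rewrite -[z k](subKr (w k)).
  by apply: le_trans (ler_normB _ _) _; lra.
apply: le_trans de.
have -> : A a b - S z a b = (A a b - S w a b) + (S w a b - S z a b) by ring.
apply: le_trans (ler_normD _ _) _.
have -> : d * K = d + D%:R * (4 * (B + 1) ^+ 3 * d) by rewrite /K; ring.
apply: lerD; first exact: Pw.
rewrite /S !summxE -sumrB; apply: le_trans (ler_norm_sum _ _ _) _.
rewrite mulr_natl -[X in _ *+ X]card_ord -sumr_const.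
by apply: ler_sum => s _; apply: prod_mx_dist.
Qed.

End ProductMatrices.
(** * Decomposition of positive semidefinite matrices *)

Section PositiveSemidefinite.
Variables (R : realType) (n : nat).
Implicit Types (B : 'M[R]_n) (v : 'cV[R]_n).

Definition quad_form B v : R := (v^T *m B *m v) 0 0.

Lemma quad_formE B v : quad_form B v = \sum_i \sum_k v i 0 * B i k * v k 0.
Proof.
rewrite /quad_form mxE exchange_big; apply: eq_bigr => k _.
by rewrite mxE mulr_suml; apply: eq_bigr => i _; rewrite mxE.
Qed.

Lemma quad_form_delta B i : quad_form B (delta_mx i 0) = B i i.
Proof. by rewrite /quad_form trmx_delta -rowE -colE !mxE. Qed.

Lemma quad_formD_delta B v t i : B^T = B ->
  quad_form B (v + t *: delta_mx i 0) =
  quad_form B v + 2 * (B *m v) i 0 * t + B i i * t ^+ 2.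
Proof.
move=> Bsym; rewrite /quad_form.
have -> : (v + t *: delta_mx i 0)^T = v^T + t *: (delta_mx 0 i : 'rV[R]_n).
  by rewrite !raddfD /= linearZ /= trmx_delta.
have E : v^T *m B *m (delta_mx i 0 : 'cV[R]_n) = (B *m v) i 0 *: 1.
  rewrite -[v^T *m B]trmxK trmx_mul Bsym trmxK -colE.
  by apply/matrixP => a b; rewrite !mxE !ord1 mulr1.
rewrite !mulmxDl !mulmxDr -!scalemxAl -!scalemxAr.
rewrite E -[delta_mx 0 i *m B *m v]mulmxA -rowE !mxE.
have := quad_form_delta B i; rewrite /quad_form trmx_delta !mxE => ->.
by rewrite eqxx /=; ring.
Qed.

Lemma psdmx_gram (T : Type) (s : seq T) (c : T -> R) (u : T -> 'I_n -> R) B :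
  (forall z, 0 <= c z) ->
  (forall i k, B i k = \sum_(z <- s) c z * (u z i * u z k)) -> psdmx B.
Proof.
move=> c0 BE; split=> [|v].
  by apply/matrixP => i k; rewrite mxE !BE; apply: eq_bigr => z _; ring.
rewrite -/(quad_form B v) quad_formE.
have -> : \sum_i \sum_k v i 0 * B i k * v k 0
    = \sum_(z <- s) c z * (\sum_i v i 0 * u z i) ^+ 2.
  under eq_bigr do under eq_bigr do rewrite BE mulr_sumr mulr_suml.
  under eq_bigr do rewrite exchange_big.
  rewrite exchange_big; apply: eq_bigr => z _ /=.
  rewrite expr2 mulr_suml mulr_sumr; apply: eq_bigr => i _.
  by rewrite mulr_sumr mulr_sumr; apply: eq_bigr => k _; ring.
by apply: sumr_ge0 => z _; rewrite mulr_ge0 // sqr_ge0.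
Qed.

(** A principal minor of size two is nonnegative: this is the discriminant of the form along
    [delta_mx k 0 + t *: delta_mx i 0]. *)
Lemma psdmx_entry_bound B i k : psdmx B -> B i k ^+ 2 <= B k k * B i i.
Proof.
case=> Bsym Bpos; apply: discriminant_bound => t.
have := Bpos (delta_mx k 0 + t *: delta_mx i 0).
by rewrite -/(quad_form _ _) quad_formD_delta // quad_form_delta -colE mxE.
Qed.

(** This is the Schur complement of [B i i]: its form at [v] is the form of [B] at
    [v - c *: delta_mx i 0], for the minimizing [c]. *)
Lemma psdmx_pivot B i : psdmx B -> 0 < B i i ->
  psdmx (\matrix_(j, k) (B j k - B i j * B i k / B i i)).
Proof.
case=> Bsym Bpos Bii; have Bs j k : B j k = B k j by rewrite -{1}Bsym mxE.
split=> [|v]; first by apply/matrixP => j k; rewrite !mxE Bs; ring.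
rewrite -/(quad_form _ v); set c := (\sum_k B i k * v k 0) / B i i.
suff -> : quad_form (\matrix_(j, k) (B j k - B i j * B i k / B i i)) v
  = quad_form B (v - c *: delta_mx i 0) by apply: Bpos.
rewrite -scaleNr quad_formD_delta // !quad_formE.
have -> : (B *m v) i 0 = c * B i i by rewrite mxE /c divfK ?gt_eqF.
transitivity (\sum_j \sum_k v j 0 * B j k * v k 0
   - (\sum_k B i k * v k 0) ^+ 2 / B i i).
  rewrite expr2 !mulr_suml -sumrB; apply: eq_bigr => j _.
  rewrite mulr_sumr mulr_suml -sumrB; apply: eq_bigr => k _.
  by rewrite mxE; ring.
have -> : \sum_k B i k * v k 0 = c * B i i by rewrite /c divfK ?gt_eqF.
by field; rewrite gt_eqF.
Qed.

(** Induction on the number of nonzero diagonal entries: splitting off a rank-one matrix leaves a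
    Schur complement with fewer of them. *)
Lemma psdmx_sum_rank1 B : psdmx B ->
  exists s : seq ('I_n -> R), B = \sum_(x <- s) \matrix_(i, k) (x i * x k).
Proof.
move: {-1}#|[set i | B i i != 0]| (leqnn #|[set i | B i i != 0]|) => d.
elim: d B => [|d IH] B Bd psdB.
  exists [::]; rewrite big_nil; apply/matrixP => i k; rewrite mxE.
  have Bii : B i i = 0.
    apply/eqP/negPn/negP => Bi.
    by move: Bd; rewrite leqn0 cards_eq0 => /eqP/setP/(_ i); rewrite !inE Bi.
  have := psdmx_entry_bound i k psdB.
  by rewrite Bii mulr0 exprn_even_le0 //= => /eqP.
have [i Bi|B0] := pickP (fun i => B i i != 0); last first.
  apply: IH => //; rewrite (_ : [set _ | _] = set0) ?cards0 //.
  by apply/setP => i; rewrite !inE B0.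
have Bpos j : 0 <= B j j.
  have := (proj2 psdB) (delta_mx j 0).
  by rewrite trmx_delta -rowE -colE !mxE.
have Bii : 0 < B i i by rewrite lt_def Bi Bpos.
have psdB' := psdmx_pivot psdB Bii.
have [|s sE] := IH _ _ psdB'.
  rewrite -ltnS (leq_trans _ Bd) //; apply/proper_card/properP; split.
    (* A zero diagonal entry stays zero, because by [psdmx_entry_bound] its whole row vanishes. *)
    apply/subsetP => j; rewrite !inE mxE; apply: contraNN => /eqP Bj.
    have := psdmx_entry_bound i j psdB.
    rewrite Bj mul0r exprn_even_le0 //= => /eqP ->.
    by rewrite !mul0r subr0.
  by exists i; rewrite !inE ?mxE // negbK mulfK ?subrr.
exists ((fun j => B i j / Num.sqrt (B i i)) :: s); rewrite big_cons -sE.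
apply/matrixP => j k; rewrite !mxE.
rewrite mulf_div -expr2 sqr_sqrtr ?ltW //.
by ring.
Qed.

End PositiveSemidefinite.

Lemma separable_sum_prod (R : realType) p q (A : 'M[R]_(p * q)) :
  separable_mx A -> exists s : seq (('I_p -> R) * ('I_q -> R)),
    A = \sum_(z <- s) prod_mx z.1 z.2.
Proof.
case=> _ [N [B [C [psd ->]]]].
apply: (big_ind (fun A => exists s : seq (('I_p -> R) * ('I_q -> R)),
    A = \sum_(z <- s) prod_mx z.1 z.2)).
- by exists [::]; rewrite big_nil.
- by move=> _ _ [s ->] [t ->]; exists (s ++ t); rewrite big_cat.
move=> a _; have [/psdmx_sum_rank1[s ->] /psdmx_sum_rank1[t ->]] := psd a.
exists [seq (x, y) | x <- s, y <- t]; rewrite big_allpairs_dep /=.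
apply/matrixP => b c; rewrite summxE !mxE !summxE mulr_suml.
apply: eq_bigr => x _; rewrite summxE mulr_sumr.
by apply: eq_bigr => y _; rewrite /prod_mx !mxE.
Qed.

Lemma sum_prod_separable (R : realType) p q N (x : 'I_N -> 'I_p -> R)
    (y : 'I_N -> 'I_q -> R) :
  kron_space (\sum_s prod_mx (x s) (y s)) ->
  separable_mx (\sum_s prod_mx (x s) (y s)).
Proof.
split=> //; exists N, (fun s => \matrix_(i, k) (x s i * x s k)),
  (fun s => \matrix_(i, k) (y s i * y s k)); split=> // s.
have psd n (u : 'I_n -> R) : psdmx (\matrix_(i, k) (u i * u k)).
  apply: (psdmx_gram (s := [:: tt]) (c := fun=> 1) (u := fun=> u)) => // i k.
  by rewrite big_seq1 mul1r mxE.
by split; apply: psd.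
Qed.
(** * Moment sequences and localizing matrices *)

Section Riesz.
Variables (R : realType) (n d : nat).
Implicit Types (w : momseq R n d) (f : {mpoly R[n]}).

Lemma riesz_linear w : linear_functional (fun f => riesz f w).
Proof.
move=> c f g; rewrite /riesz mulr_sumr -big_split /=.
by apply: eq_bigr => m _; rewrite mcoeffD mcoeffZ; ring.
Qed.

Lemma riesz_monomial w m : riesz ('X_[m]) w = mom_at w m.
Proof.
rewrite /riesz /mom_at; case: insubP => [m0 _ <-|md] /=.
  rewrite (bigD1 m0) //= mcoeffX eqxx mul1r big1 ?addr0 // => m1 m10.
  by rewrite mcoeffX eq_sym (inj_eq val_inj) (negbTE m10) mul0r.
rewrite big1 // => m1 _; rewrite mcoeffX.
case: eqP => [E|]; last by rewrite mul0r.
by case/negP: md; rewrite E bmdeg.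
Qed.

(** Moments of an atomic measure, with mass [c t] at the point [z t]. *)
Definition evaluation_moments (T : Type) (s : seq T) (c : T -> R)
    (z : T -> 'I_n -> R) : momseq R n d :=
  [ffun m : 'X_{1..n < d.+1} =>
    \sum_(t <- s) c t * ('X_[m] : {mpoly R[n]}).@[z t]].

Lemma riesz_evaluation (T : Type) (s : seq T) c (z : T -> 'I_n -> R) f :
  (msize f <= d.+1)%N ->
  riesz f (evaluation_moments s c z) = \sum_(t <- s) c t * f.@[z t].
Proof.
move=> fd; rewrite /riesz.
under eq_bigr do rewrite ffunE mulr_sumr.
rewrite exchange_big; apply: eq_bigr => t _ /=.
rewrite [in RHS](mpolywE fd) raddf_sum mulr_sumr; apply: eq_bigr => m _.
by rewrite /= mevalZ; ring.
Qed.

End Riesz.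

Section Localizing.
Variables (R : realType) (n k : nat).
Implicit Types (theta f : {mpoly R[n]}).

Lemma msize_mon d (a : 'I_(nmon n d)) :
  (msize ('X_[mon a] : {mpoly R[n]}) <= d.+1)%N.
Proof. by rewrite msizeX bmdeg. Qed.

(** Rounding up half the degree of [theta] in [loc_deg] leaves room for both multipliers within
    degree [2 * k]. *)
Lemma msize_localizing theta u v : (msize theta <= (2 * k).+1)%N ->
  (msize u <= (loc_deg k theta).+1)%N -> (msize v <= (loc_deg k theta).+1)%N ->
  (msize (theta * u * v)%R <= (2 * k).+1)%N.
Proof.
have [->|t0] := eqVneq theta 0; first by rewrite !mul0r mmeasure0.
have [->|u0] := eqVneq u 0; first by rewrite mulr0 mul0r mmeasure0.
have [->|v0] := eqVneq v 0; first by rewrite mulr0 mmeasure0.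
have sM (f g : {mpoly R[n]}) : f != 0 -> g != 0 ->
    msize (f * g) = (msize f + msize g).-1 by exact: msizeM.
rewrite /loc_deg !sM ?mulf_neq0 //.
have := uphalfK (msize theta).-1; have := leq_b1 (odd (msize theta).-1).
lia.
Qed.

Lemma locmx_evaluation (T : Type) (s : seq T) c (z : T -> 'I_n -> R) theta :
  (msize theta <= (2 * k).+1)%N -> forall a b,
  locmx theta (evaluation_moments (2 * k) s c z) a b =
  \sum_(t <- s) c t * theta.@[z t] *
    (('X_[mon a] : {mpoly R[n]}).@[z t] * ('X_[mon b] : {mpoly R[n]}).@[z t]).
Proof.
move=> td a b; rewrite mxE riesz_evaluation; last first.
  by apply: msize_localizing; rewrite ?msize_mon.
by apply: eq_bigr => t _; rewrite !mevalM; ring.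
Qed.

Lemma locmx_evaluation_psd (T : Type) (s : seq T) c (z : T -> 'I_n -> R) theta :
  (msize theta <= (2 * k).+1)%N -> (forall t, 0 <= c t * theta.@[z t]) ->
  psdmx (locmx theta (evaluation_moments (2 * k) s c z)).
Proof.
move=> td c0; apply: (psdmx_gram (s := s) (c := fun t => c t * theta.@[z t])
  (u := fun t a => ('X_[mon a] : {mpoly R[n]}).@[z t])) => // a b.
exact: locmx_evaluation.
Qed.

Lemma locmx_quadratic theta (w : momseq R n (2 * k)) u v :
  (msize u <= (loc_deg k theta).+1)%N -> (msize v <= (loc_deg k theta).+1)%N ->
  riesz (theta * u * v) w =
  ((coefvec (loc_deg k theta) u)^T *m locmx theta w
     *m coefvec (loc_deg k theta) v) 0 0.
Proof.
by move=> ud vd; rewrite -((locmxP w (locmx theta w)).2 erefl u v ud vd).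
Qed.

End Localizing.

(** * Feasibility of the relaxation against separability *)

Section Relaxation.
Variables (R : realType) (p q : nat).

Lemma msize_sum_le n (I : finType) (F : I -> {mpoly R[n]}) d :
  (forall i, (msize (F i) <= d)%N) -> (msize (\sum_i F i)%R <= d)%N.
Proof.
by move=> Fd; apply: leq_trans (mmeasure_sum _ _ _ _) _; apply/bigmax_leqP.
Qed.

Lemma msize_hpolys h : h \in hpolys R p q -> (msize h <= 3)%N.
Proof.
have X2 (i : 'I_(p + q)) : (msize ('X_i ^+ 2 : {mpoly R[p + q]}) <= 3)%N.
  by rewrite expr2; apply: msizeMX_le; rewrite msizeX mdeg1.
have B1 : (msize (- 1 : {mpoly R[p + q]}) <= 3)%N by rewrite mmeasureN msize1.
by rewrite !inE => /orP[] /eqP->; apply: msizeD_leq => //;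
  apply: msize_sum_le => i; apply: X2.
Qed.

Lemma msize_gpolys g : g \in gpolys R p q -> (msize g <= 3)%N.
Proof.
by rewrite !inE => /orP[] /eqP->; apply: msize_sum_le => i;
  rewrite msizeX mdeg1.
Qed.

Lemma hpolys_bounded_var (i : 'I_(p + q)) :
  exists (h : {mpoly R[p + q]}) (J : pred 'I_(p + q)),
  h \in hpolys R p q /\ h = 'X_i * 'X_i + \sum_(j | J j) 'X_j * 'X_j - 1.
Proof.
rewrite -[i]splitK; case: (split i) => a /=.
  exists (\sum_(i < p) xvar R q i ^+ 2 - 1).
  exists (fun j => if split j is inl b then b != a else false).
  rewrite inE eqxx; split=> //; congr (_ - 1); rewrite (bigD1 a) //=.
  rewrite big_split_ord /= [X in _ = _ + (_ + X)]big1 ?addr0; last first.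
    by move=> j; rewrite (unsplitK (inr j)).
  congr (_ + _); apply: eq_bigl => b.
  by rewrite (unsplitK (inl b)).
exists (\sum_(j < q) yvar R p j ^+ 2 - 1).
exists (fun j => if split j is inr b then b != a else false).
rewrite !inE eqxx orbT; split=> //; congr (_ - 1); rewrite (bigD1 a) //=.
rewrite big_split_ord /= [X in _ = _ + (X + _)]big1 ?add0r; last first.
  by move=> j; rewrite (unsplitK (inl j)).
congr (_ + _); apply: eq_bigl => b.
by rewrite (unsplitK (inr b)).
Qed.

Lemma feasible_truncated_state F a k (w : momseq R (p + q) (2 * k)) :
  (0 < k)%N -> feasible (relaxation F a k) w ->
  truncated_state (fun h => h \in hpolys R p q) k (fun f => riesz f w).
Proof.
move=> k0 [_ Lh [_ Mpos] _]; split; first exact: riesz_linear.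
  move=> u uk; rewrite -[u in u * _]mul1r locmx_quadratic ?Mpos //.
    by rewrite /loc_deg msize1 /= subn0.
  by rewrite /loc_deg msize1 /= subn0.
move=> h u v hH uk vk; have h3 := msize_hpolys hH.
(* Since [h] is at most quadratic, its localizing matrix covers all multipliers of degree below
   [k]. *)
have dh : (k <= (loc_deg k h).+1)%N by rewrite /loc_deg; lia.
rewrite locmx_quadratic; try exact: leq_trans dh.
by rewrite Lh // mulmx0 mul0mx mxE.
Qed.

(** Each Kronecker factor is symmetric on its own, so both partial transposes fix [A]. This recovers
    the entries that [edge] leaves out. *)
Lemma kron_space_sym (A : 'M[R]_(p * q)) i j k l : kron_space A ->
  A (mxtens_index (i, j)) (mxtens_index (k, l)) =
    A (mxtens_index (k, j)) (mxtens_index (i, l)) /\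
  A (mxtens_index (i, j)) (mxtens_index (k, l)) =
    A (mxtens_index (i, l)) (mxtens_index (k, j)).
Proof.
case=> N [c [B [C [BC ->]]]]; rewrite !summxE.
have E s i' j' k' l' : (c s *: tensmx (B s) (C s)) (mxtens_index (i', j'))
    (mxtens_index (k', l')) = c s * (B s i' k' * C s j' l').
  by rewrite mxE tensmxE.
split; apply: eq_bigr => s _; rewrite !E; congr (_ * (_ * _)).
  by rewrite -{1}(proj1 (BC s)) mxE.
by rewrite -{1}(proj2 (BC s)) mxE.
Qed.

Definition xyxy i j k l : {mpoly R[p + q]} :=
  quartic R (lshift q i) (rshift p j) (lshift q k) (rshift p l).

(** The constraint prescribes only the entries with [i <= k] and [j <= l]. The others follow from
    commuting variables on one side and partial transposes on the other. *)
Lemma feasible_entries (F : polyxy R p q) (A : 'M[R]_(p * q)) m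
    (w : momseq R (p + q) (2 * m)) :
  kron_space A -> feasible (relaxation F (edge_entries A) m) w ->
  forall i j k l, riesz (xyxy i j k l) w =
    A (mxtens_index (i, j)) (mxtens_index (k, l)).
Proof.
move=> hA [/ffunP Ew _ _ _].
have base (i k : 'I_p) (j l : 'I_q) : (i <= k)%N -> (j <= l)%N ->
    riesz (xyxy i j k l) w = A (mxtens_index (i, j)) (mxtens_index (k, l)).
  move=> ik jl; have ikjl : (i <= k)%N && (j <= l)%N by rewrite ik.
  pose b : edge p q := exist _ ((i, j), (k, l)) ikjl.
  have := Ew b; rewrite !ffunE /= => <-; rewrite -riesz_monomial; congr riesz.
  by rewrite /xyxy /quartic /edge_mnm /= -!mpolyXD !addmA.
move=> i j k l.
have swap1 : xyxy i j k l = xyxy k j i l by rewrite /xyxy /quartic; ring.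
have swap2 : xyxy i j k l = xyxy i l k j by rewrite /xyxy /quartic; ring.
have swap3 : xyxy i j k l = xyxy k l i j by rewrite /xyxy /quartic; ring.
have [s1 s2] := kron_space_sym i j k l hA.
have [s3 s4] := kron_space_sym k l i j hA.
have [ik|/ltnW ki] := leqP i k; have [jl|/ltnW lj] := leqP j l.
- exact: base.
- by rewrite swap2 s2; apply: base.
- by rewrite swap1 s1; apply: base.
- by rewrite swap3 s1 -s4; apply: base.
Qed.

(** The sign makes the coordinate sum nonnegative and cancels in products of two coordinates. For
    [x = 0] this is the zero vector. *)
Definition signed_unit n (x : 'I_n -> R) (i : 'I_n) : R :=
  (if 0 <= \sum_i x i then 1 else - 1) * (x i / norm2 x).

Lemma signed_unit_norm n (x : 'I_n -> R) :
  norm2 x != 0 -> \sum_i signed_unit x i ^+ 2 = 1.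
Proof.
move=> x0; rewrite -(norm2_unit1 x0); apply: eq_bigr => i _.
by rewrite /signed_unit; case: ifP => _; ring.
Qed.

Lemma signed_unit_sum_ge0 n (x : 'I_n -> R) : 0 <= \sum_i signed_unit x i.
Proof.
rewrite -mulr_sumr -mulr_suml; case: ifPn => [x0|].
  by rewrite mul1r divr_ge0 ?norm2_ge0.
rewrite -ltNge => x0.
by rewrite mulN1r -mulNr divr_ge0 ?norm2_ge0 // oppr_ge0 ltW.
Qed.

Lemma signed_unit_prod n (x : 'I_n -> R) i k :
  norm2 x ^+ 2 * (signed_unit x i * signed_unit x k) = x i * x k.
Proof.
rewrite -[in RHS](norm2_unit x i) -[in RHS](norm2_unit x k) /signed_unit.
by case: ifP => _; ring.
Qed.

Definition joint_point (z : ('I_p -> R) * ('I_q -> R)) (a : 'I_(p + q)) : R :=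
  match split a with
  | inl i => signed_unit z.1 i
  | inr j => signed_unit z.2 j
  end.

Lemma joint_point_l z i : joint_point z (lshift q i) = signed_unit z.1 i.
Proof. by rewrite /joint_point (unsplitK (inl i)). Qed.

Lemma joint_point_r z j : joint_point z (rshift p j) = signed_unit z.2 j.
Proof. by rewrite /joint_point (unsplitK (inr j)). Qed.

(** The witness comes from an atomic measure: each summand of [A] gives an atom at the pair of its
    signed unit vectors. *)
Lemma separable_feasible (F : polyxy R p q) (A : 'M[R]_(p * q)) k :
  (3 <= k)%N -> separable_mx A ->
  exists w, feasible (relaxation F (edge_entries A) k) w.
Proof.
move=> k3 /separable_sum_prod[s ->].
(* The weight restores the scale lost in normalizing both vectors. *)
pose c (z : ('I_p -> R) * ('I_q -> R)) := norm2 z.1 ^+ 2 * norm2 z.2 ^+ 2.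
have c0 z : 0 <= c z by rewrite mulr_ge0 ?sqr_ge0.
exists (evaluation_moments (2 * k) s c joint_point); split.
- apply/ffunP => -[[[i j] [l m]] b]; rewrite !ffunE /= -riesz_monomial.
  rewrite riesz_evaluation; last first.
    by rewrite msizeX /edge_mnm /= !mdegD !mdeg1; lia.
  rewrite summxE; apply: eq_bigr => z _; rewrite prod_mxE.
  rewrite /edge_mnm /= !mpolyXD !mevalM !mevalXU !joint_point_l !joint_point_r.
  by rewrite -(signed_unit_prod z.1) -(signed_unit_prod z.2) /c; ring.
- move=> h hH; have h3 := msize_hpolys hH; apply/matrixP => a b.
  rewrite locmx_evaluation ?mxE; last by apply: leq_trans h3 _; lia.
  rewrite big1 // => z _.
  suff -> : c z * h.@[joint_point z] = 0 by rewrite mul0r.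
  (* A zero vector is not moved onto the sphere, but then its atom has weight 0. *)
  have [x0|x0] := eqVneq (norm2 z.1) 0; first by rewrite /c x0 expr0n !mul0r.
  have [y0|y0] := eqVneq (norm2 z.2) 0.
    by rewrite /c y0 expr0n mulr0 mul0r.
  suff -> : h.@[joint_point z] = 0 by rewrite mulr0.
  move: hH; rewrite !inE => /orP[] /eqP ->; rewrite mevalB meval1 raddf_sum /=.
    rewrite -[X in _ - X](signed_unit_norm x0).
    apply/eqP; rewrite subr_eq0; apply/eqP.
    by apply: eq_bigr => i _; rewrite rmorphXn /= mevalXU joint_point_l.
  rewrite -[X in _ - X](signed_unit_norm y0).
  apply/eqP; rewrite subr_eq0; apply/eqP.
  by apply: eq_bigr => i _; rewrite rmorphXn /= mevalXU joint_point_r.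
- by apply: locmx_evaluation_psd => [|z]; rewrite ?msize1 // meval1 mulr1.
move=> g gG; have g3 := msize_gpolys gG.
apply: locmx_evaluation_psd => [|z]; first by apply: leq_trans g3 _; lia.
rewrite mulr_ge0 //.
move: gG; rewrite !inE => /orP[] /eqP ->; rewrite raddf_sum /=.
  under eq_bigr do rewrite mevalXU joint_point_l.
  exact: signed_unit_sum_ge0.
under eq_bigr do rewrite mevalXU joint_point_r.
exact: signed_unit_sum_ge0.
Qed.

(** The sphere constraints, used in turn, expand the mass into the values at [x_i ^ 2] and then at
    [x_i ^ 2 y_j ^ 2], which are the diagonal entries. The second expansion has multipliers [x_i],
    hence [1 < k]. *)
Lemma feasible_mass F (A : 'M[R]_(p * q)) k (w : momseq R (p + q) (2 * k)) :
  (1 < k)%N -> kron_space A -> feasible (relaxation F (edge_entries A) k) w ->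
  riesz 1 w = \tr A.
Proof.
move=> k1 hA fw; have ts := feasible_truncated_state (ltnW k1) fw.
have Ll := ts_linear ts.
have Lh (h u v : {mpoly R[p + q]}) : h \in hpolys R p q ->
    (msize u <= k)%N -> (msize v <= k)%N -> riesz (h * u * v) w = 0.
  exact: (ts_ideal ts).
have szX (i : 'I_(p + q)) : (msize ('X_i : {mpoly R[p + q]}) <= k)%N.
  by rewrite msizeX mdeg1.
have one : riesz 1 w = \sum_i riesz ('X_(lshift q i) * 'X_(lshift q i)) w.
  have := Lh (\sum_(i < p) xvar R q i ^+ 2 - 1) 1 1.
  rewrite !inE eqxx !mulr1 msize1 => /(_ isT (ltnW k1) (ltnW k1)) /eqP.
  rewrite (functionalB Ll) (functional_sum Ll) subr_eq0 => /eqP <-.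
  by apply: eq_bigr => i _; rewrite expr2.
rewrite one mxtrace_tens; apply: eq_bigr => i _.
have := Lh (\sum_(j < q) yvar R p j ^+ 2 - 1) 'X_(lshift q i) 'X_(lshift q i).
rewrite !inE eqxx orbT => /(_ isT (szX _) (szX _)) /eqP.
rewrite -mulrA mulrBl mul1r mulr_suml (functionalB Ll) (functional_sum Ll).
rewrite subr_eq0 => /eqP <-.
apply: eq_bigr => j _; rewrite -(feasible_entries hA fw); congr riesz.
by rewrite /xyxy /quartic /yvar; ring.
Qed.

Lemma potential_ge0 n (H : {mpoly R[n]} -> Prop) d L :
  truncated_state H d L -> 0 <= potential L.
Proof.
by move=> ts; apply: sumr_ge0 => i _; rewrite divr_ge0 ?sqr_ge0 ?(mass_ge0 ts).
Qed.

(** The constants are chosen in the order [d], [e], [N], [k]. This is possible because the mass is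
    [\tr A] at every order, so that [N] does not depend on [k]. *)
Lemma cofinally_feasible_separable F (A : 'M[R]_(p * q)) : kron_space A ->
  (forall N, exists k, (N <= k)%N /\
    exists w, feasible (relaxation F (edge_entries A) k) w) ->
  separable_mx A.
Proof.
move=> hA feas.
suff [N [x [y AE]]] : exists (N : nat) (x : 'I_N -> 'I_p -> R)
    (y : 'I_N -> 'I_q -> R), A = \sum_s prod_mx (x s) (y s).
  by move: hA; rewrite AE; apply: sum_prod_separable.
apply: prod_mx_sum_closed => d d0.
have tr0 : 0 <= \tr A.
  have [k [k2 [w fw]]] := feas 2%N.
  rewrite -(feasible_mass k2 hA fw).
  exact: mass_ge0 (feasible_truncated_state (ltnW k2) fw).
(* Half of [d] is reserved for the concentration error [3 * e * \tr A]; the added 1 allows for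
   [\tr A = 0]. *)
have [e e0 eE] : exists2 e, 0 < e & 6 * e * (\tr A + 1) = d.
  have tr1 : 0 < \tr A + 1 by rewrite ltr_wpDl.
  exists (d / (6 * (\tr A + 1))); first by rewrite divr_gt0 // mulr_gt0.
  by field; rewrite gt_eqF.
have e4d : 0 < e ^+ 4 * d by rewrite mulr_gt0 // exprn_gt0.
(* More than [X] rounds push the residual mass [r] below the other half of [d]. *)
pose X := 2 * ((p + q)%:R * \tr A) / (e ^+ 4 * d).
have X0 : 0 <= X.
  by apply: divr_ge0; last exact: ltW; do 2!apply: mulr_ge0 => //.
have := archi_boundP X0; set N := Num.bound X => XN.
(* Up to [N] orders are spent on splittings, and 3 remain for [quartic_concentration]. *)
have [k [kN [w fw]]] := feas (N + 3)%N.
have k0 : (1 < k)%N by lia.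
have tsk := feasible_truncated_state (ltnW k0) fw.
have tsN := truncated_state_leq kN tsk.
have [s [r [s0 /andP[r0 _] rN approx]]] :=
  quartic_approximation hpolys_bounded_var (ltW e0) tsN.
rewrite /= (feasible_mass k0 hA fw) in rN approx.
have r_small : r <= d / 2.
  have pot := potential_ge0 tsN.
  have : N%:R * e ^+ 4 * r <= (p + q)%:R * \tr A by lra.
  move: XN; rewrite /X ltr_pdivrMr // => XN rN'.
  have Ne0 : 0 < N%:R * e ^+ 4.
    apply: mulr_gt0; last exact: exprn_gt0.
    rewrite ltr0n lt0n; apply/negP => /eqP N0.
    have : 0 <= (p + q)%:R * \tr A by rewrite mulr_ge0.
    by move: XN; rewrite N0 mul0r; lra.
  by rewrite -(ler_pM2l Ne0); lra.
exists (size s).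
exists (fun t i =>
  let z := tnth (in_tuple s) t in Num.sqrt z.1 * z.2 (lshift q i)).
exists (fun t j => let z := tnth (in_tuple s) t in z.2 (rshift p j)).
move=> a b; case: (mxtens_indexP a) => i j; case: (mxtens_indexP b) => k' l.
rewrite -(feasible_entries hA fw) summxE.
have -> : \sum_t (prod_mx
      (fun i => let z := tnth (in_tuple s) t in Num.sqrt z.1 * z.2 (lshift q i))
      (fun j => let z := tnth (in_tuple s) t in z.2 (rshift p j)))
        (mxtens_index (i, j)) (mxtens_index (k', l))
    = \sum_(z <- s) z.1 * (z.2 (lshift q i) * z.2 (rshift p j)
        * (z.2 (lshift q k') * z.2 (rshift p l))).
  rewrite [RHS]big_tnth; apply: eq_bigr => t _; rewrite prod_mxE /=.
  have z0 : 0 <= (tnth (in_tuple s) t).1.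
    exact: (all_tnthP (t := in_tuple s) s0).
  by rewrite -[in RHS](sqr_sqrtr z0); ring.
apply: le_trans (approx _ _ _ _) _.
by have : 3 * e * \tr A <= d / 2; lra.
Qed.

End Relaxation.

Theorem theorem4p3 (R : realType) (p q : nat) (hp : (0 < p)%N) (hq : (0 < q)%N)
  (A : 'M[R]_(p * q)) (hA : kron_space A)
  (F : polyxy R p q) (hF : sos_le 6 F) :
  ((exists k : nat,
      (3 <= k)%N /\ infeasible (relaxation F (edge_entries A) k)) ->
    ~ separable_mx A) /\
  (~ separable_mx A ->
    exists N : nat, forall k : nat, (3 <= k)%N -> (N <= k)%N ->
      infeasible (relaxation F (edge_entries A) k)).
Proof.
split=> [[k [k3 infeas]] sepA|nsepA].
  exact/infeas/separable_feasible.
apply: boolp.contrapT => never; apply: nsepA.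
apply: (cofinally_feasible_separable (F := F)) => // N.
apply: boolp.contrapT => no; apply: never; exists N => k _ Nk fk.
by apply: no; exists k.
Qed.
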